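(* Let $1<\alpha\le2$ and let $u:\mathbb{Z}^+\to\mathbb{C}$ be a finitely supported function with $|u(0)|=\max_{n\in\mathbb{Z}^+}|u(n)|$. Then $$\sum_{n=1}^\infty|u(n)-u(n-1)|^2\,n^\alpha\ \ge\ \frac{(\alpha-1)^2}{4}\sum_{n=1}^\infty|u(n)|^2\,n^{\alpha-2}.$$
   Context: $\mathbb{Z}^+=\{0,1,2,\dots\}$ is the set of non-negative integers. *)

(* Defs.v *)
From Stdlib Require Import Reals List.
From Coquelicot Require Import Coquelicot.
Open Scope R_scope.

Definition finitely_supported (u : nat -> C) : Prop :=
  exists l : list nat, forall n : nat, u n <> RtoC 0 -> In n l.

(* The sum of a n over n >= 1; the term a 0 is never used. *)
Definition Series_from_1 (a : nat -> R) : R := Series (fun k : nat => a (S k)).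

(* Main.v *)
Require Import Defs.
From Stdlib Require Import Reals List.
From Coquelicot Require Import Coquelicot.
From Stdlib Require Import Lra Psatz Lia.
Open Scope R_scope.

(** Replacing [u] by its modulus only decreases the left side, so it is enough
    to treat a nonnegative sequence [a]. Write [s = (alpha - 1) / 2], so that
    [0 < s <= 1/2] and the constant is [s^2]. The argument is a ground state
    substitution: for every [t > 0],
    [(a - b)^2 >= t / (1 + t) * b^2 - t * a^2] ([weighted_diff_sq]). Apply this
    to each edge [(n-1, n)] with [t = s / (n + 1/2)], which is approximately the
    relative decrement of the ground state [(n + 1)^(-s)], an approximate
    minimizer of the continuous Hardy inequality. The [b]-part of this bound is
    [flux_density s n * b^2].

    The vertex [n] then receives [flux_density s (n+1)] from the edge on its
    right and pays [n^alpha * s / (n + 1/2)] to the edge on its left, and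
    [vertex_balance] says that the net gain is at least [s^2 * n^(alpha-2)].
    With Bernoulli's inequality [Rpower_bernoulli] the powers drop out of this
    estimate and what is left is a cubic polynomial in [s], nonnegative for
    [n >= 1] ([vertex_balance_rational]). Summing over [n] telescopes: the
    vertex [0] only contributes a nonnegative term, and finite support kills the
    term at the other end. *)

(** The difference of the two sides is
    [(sqrt (1 + t) * a - b / sqrt (1 + t))^2]. *)
Lemma weighted_diff_sq (a b t : R) :
  0 < t -> t / (1 + t) * b ^ 2 - t * a ^ 2 <= (a - b) ^ 2.
Proof.
  intros ht.
  assert (h : (a - b) ^ 2 - (t / (1 + t) * b ^ 2 - t * a ^ 2)
              = ((1 + t) * a - b) ^ 2 / (1 + t)) by (field; lra).
  assert (0 <= ((1 + t) * a - b) ^ 2 / (1 + t)).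
  { apply Rdiv_le_0_compat; [apply pow2_ge_0 | lra]. }
  lra.
Qed.

(** Weighted arithmetic-geometric mean inequality for [q] and [1]: with
    [M = p q + (1 - p)], average the bounds [1 + ln (q / M) <= q / M] and
    [1 + ln (1 / M) <= 1 / M]. *)
Lemma Rpower_bernoulli (q p : R) :
  0 < q -> 0 <= p <= 1 -> Rpower q p <= p * q + (1 - p).
Proof.
  intros hq hp.
  set (M := p * q + (1 - p)).
  assert (hM : 0 < M) by (unfold M; destruct (Req_dec p 1); nra).
  assert (tangent : forall z, 0 < z -> ln z - ln M <= z / M - 1).
  { intros z hz. rewrite <- ln_div by assumption.
    generalize (exp_ineq1_le (ln (z / M))).
    rewrite exp_ln by (apply Rdiv_lt_0_compat; assumption). lra. }
  assert (hln : p * ln q <= ln M).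
  { generalize (tangent q hq) (tangent 1 Rlt_0_1). rewrite ln_1. intros h1 h2.
    assert (e : p * (q / M - 1) + (1 - p) * (1 / M - 1) = 0).
    { replace (p * (q / M - 1) + (1 - p) * (1 / M - 1))
        with ((p * q + (1 - p)) / M - 1) by (field; lra).
      fold M. field. lra. }
    nra. }
  unfold Rpower. rewrite <- (exp_ln M hM).
  destruct hln as [h | h]; [left; now apply exp_increasing | right; now rewrite h].
Qed.

(** Bernoulli at [q = x / (x + 1)], with the denominators cleared. *)
Lemma Rpower_succ_lower (x s : R) :
  1 <= x -> 0 < s <= 1 / 2 ->
  (x + 1) * Rpower x (2 * s) <= (x + 1 - 2 * s) * Rpower (x + 1) (2 * s).
Proof.
  intros hx hs.
  assert (hq : 0 < x / (x + 1)) by (apply Rdiv_lt_0_compat; lra).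
  assert (hB := Rpower_bernoulli _ (2 * s) hq ltac:(lra)).
  assert (hmul : Rpower x (2 * s)
                 = Rpower (x / (x + 1)) (2 * s) * Rpower (x + 1) (2 * s)).
  { rewrite Rpower_mult_distr by lra. f_equal. field. lra. }
  rewrite hmul.
  replace ((x + 1 - 2 * s) * Rpower (x + 1) (2 * s))
    with ((x + 1) * ((2 * s * (x / (x + 1)) + (1 - 2 * s))
                     * Rpower (x + 1) (2 * s))) by (field; lra).
  apply Rmult_le_compat_l; [lra |].
  apply Rmult_le_compat_r; [left; apply exp_pos | assumption].
Qed.

(** What [vertex_balance] becomes after division by [s * x^(2 s - 1)] once
    [(x + 1)^(2 s)] has been bounded below by Bernoulli. *)
Lemma vertex_balance_rational (x s : R) :
  1 <= x -> 0 < s <= 1 / 2 ->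
  s + x ^ 2 / (x + 1 / 2)
  <= (x + 1) ^ 2 * x / ((x + 1 - 2 * s) * (x + 3 / 2 + s)).
Proof.
  intros hx hs.
  (* The cleared numerator, expanded in powers of [x - 1]: each coefficient is
     positive on the whole range of [s]. *)
  assert (hnum : 0 <= (x - 1) ^ 2 * (1 / 2 - s + 3 * s ^ 2)
                      + (x - 1) * (3 / 2 - 19 / 4 * s + 17 / 2 * s ^ 2 + 2 * s ^ 3)
                      + (1 - 9 / 2 * s + 13 / 2 * s ^ 2 + 3 * s ^ 3)).
  { assert (0 < s ^ 3) by (apply pow_lt; lra).
    assert (0 <= 1 / 2 - s + 3 * s ^ 2) by nra.
    assert (0 <= 3 / 2 - 19 / 4 * s + 17 / 2 * s ^ 2 + 2 * s ^ 3) by nra.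
    assert (0 <= 1 - 9 / 2 * s + 13 / 2 * s ^ 2 + 3 * s ^ 3) by nra.
    assert (0 <= (x - 1) ^ 2) by apply pow2_ge_0.
    apply Rplus_le_le_0_compat; [apply Rplus_le_le_0_compat |]; [| | assumption];
      apply Rmult_le_pos; lra. }
  set (num := _ + _ + _) in hnum.
  assert (h : (x + 1) ^ 2 * x / ((x + 1 - 2 * s) * (x + 3 / 2 + s))
              - (s + x ^ 2 / (x + 1 / 2))
              = num / ((x + 1 / 2) * ((x + 1 - 2 * s) * (x + 3 / 2 + s)))).
  { unfold num. field. lra. }
  assert (0 <= num / ((x + 1 / 2) * ((x + 1 - 2 * s) * (x + 3 / 2 + s)))).
  { apply Rdiv_le_0_compat; [exact hnum |].
    repeat apply Rmult_lt_0_compat; lra. }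
  lra.
Qed.

(** The coefficient [t / (1 + t)] of [weighted_diff_sq] for
    [t = s / (x + 1/2)], times the edge weight [x^alpha]. *)
Definition flux_density (s x : R) : R :=
  Rpower x (1 + 2 * s) * (s / (x + 1 / 2 + s)).

Lemma flux_density_pos (s x : R) : 0 < s -> 0 < x -> 0 < flux_density s x.
Proof.
  intros hs hx. apply Rmult_lt_0_compat; [apply exp_pos |].
  apply Rdiv_lt_0_compat; lra.
Qed.

(** This is where the choice [t = s / (x + 1/2)] matters: with the simpler
    [s / x] the inequality fails for small [s]. *)
Lemma vertex_balance (x s : R) :
  1 <= x -> 0 < s <= 1 / 2 ->
  s ^ 2 * Rpower x (2 * s - 1) + Rpower x (1 + 2 * s) * (s / (x + 1 / 2))
  <= flux_density s (x + 1).
Proof.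
  intros hx hs. unfold flux_density.
  set (P := Rpower x (2 * s - 1)).
  assert (hP : 0 < P) by apply exp_pos.
  assert (e0 : Rpower x (2 * s) = x * P).
  { unfold P. rewrite <- (Rpower_1 x) at 2 by lra.
    rewrite <- Rpower_plus. f_equal. ring. }
  assert (e1 : Rpower x (1 + 2 * s) = x ^ 2 * P).
  { rewrite Rpower_plus, Rpower_1, e0 by lra. ring. }
  assert (e2 : Rpower (x + 1) (1 + 2 * s) = (x + 1) * Rpower (x + 1) (2 * s)).
  { rewrite Rpower_plus, Rpower_1 by lra. ring. }
  assert (hB := Rpower_succ_lower x s hx hs).
  assert (hR := vertex_balance_rational x s hx hs).
  rewrite e0 in hB. rewrite e1, e2.
  set (Q := Rpower (x + 1) (2 * s)) in *.
  assert (hQ : (x + 1) * x * P / (x + 1 - 2 * s) <= Q).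
  { apply Rle_div_l; lra. }
  apply Rle_trans with
    ((x + 1) * ((x + 1) * x * P / (x + 1 - 2 * s)) * (s / (x + 3 / 2 + s))).
  - replace (s ^ 2 * P + x ^ 2 * P * (s / (x + 1 / 2)))
      with (s * P * (s + x ^ 2 / (x + 1 / 2))) by (field; lra).
    replace ((x + 1) * ((x + 1) * x * P / (x + 1 - 2 * s)) * (s / (x + 3 / 2 + s)))
      with (s * P * ((x + 1) ^ 2 * x / ((x + 1 - 2 * s) * (x + 3 / 2 + s))))
      by (field; lra).
    apply Rmult_le_compat_l; [nra | exact hR].
  - replace (x + 1 + 1 / 2 + s) with (x + 3 / 2 + s) by lra.
    apply Rmult_le_compat_r; [left; apply Rdiv_lt_0_compat; lra |].
    apply Rmult_le_compat_l; lra.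
Qed.

(** Summand by summand, the Hardy inequality holds up to a discrete
    derivative of [flux_density s n * a (n-1)^2]. *)
Lemma hardy_step (s x a b : R) :
  1 <= x -> 0 < s <= 1 / 2 ->
  s ^ 2 * (a ^ 2 * Rpower x (2 * s - 1))
    + (flux_density s x * b ^ 2 - flux_density s (x + 1) * a ^ 2)
  <= (a - b) ^ 2 * Rpower x (1 + 2 * s).
Proof.
  intros hx hs.
  set (W := Rpower x (1 + 2 * s)).
  assert (hW : 0 < W) by apply exp_pos.
  assert (ht : 0 < s / (x + 1 / 2)) by (apply Rdiv_lt_0_compat; lra).
  assert (hd := weighted_diff_sq a b _ ht).
  replace (s / (x + 1 / 2) / (1 + s / (x + 1 / 2)))
    with (s / (x + 1 / 2 + s)) in hd by (field; lra).
  apply (Rmult_le_compat_r W) in hd; [| lra].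
  assert (hv := vertex_balance x s hx hs). fold W in hv.
  apply (Rmult_le_compat_r (a ^ 2)) in hv; [| apply pow2_ge_0].
  unfold flux_density at 1. fold W.
  generalize hd hv. generalize (Rpower x (2 * s - 1)) (flux_density s (x + 1)).
  intros. lra.
Qed.

Lemma hardy_partial_sum (s : R) (a : nat -> R) (N : nat) :
  0 < s <= 1 / 2 ->
  s ^ 2 * sum_n (fun k => a (S k) ^ 2 * Rpower (INR (S k)) (2 * s - 1)) N
    + (flux_density s 1 * a 0%nat ^ 2
       - flux_density s (INR (S (S N))) * a (S N) ^ 2)
  <= sum_n (fun k => (a (S k) - a k) ^ 2 * Rpower (INR (S k)) (1 + 2 * s)) N.
Proof.
  intros hs.
  assert (step : forall k,
    s ^ 2 * (a (S k) ^ 2 * Rpower (INR (S k)) (2 * s - 1))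
      + (flux_density s (INR (S k)) * a k ^ 2
         - flux_density s (INR (S (S k))) * a (S k) ^ 2)
    <= (a (S k) - a k) ^ 2 * Rpower (INR (S k)) (1 + 2 * s)).
  { intros k. rewrite (S_INR (S k)). apply hardy_step; [| exact hs].
    rewrite S_INR. generalize (pos_INR k). lra. }
  induction N as [| N IH].
  - rewrite !sum_O. exact (step 0%nat).
  - rewrite !sum_Sn. change (@plus R_AbelianMonoid) with Rplus.
    generalize (step (S N)). lra.
Qed.

Lemma Series_eventually_zero (a : nat -> R) (N : nat) :
  (forall n, (N < n)%nat -> a n = 0) -> Series a = sum_n a N.
Proof.
  intros ha. apply is_series_unique.
  apply filterlim_ext_loc with (fun _ => sum_n a N); [| apply filterlim_const].
  exists N. intros n hn. induction hn as [| n hn IH]; [reflexivity |].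
  rewrite sum_Sn, ha, IH by lia. symmetry. apply Rplus_0_r.
Qed.

Lemma finitely_supported_bound (u : nat -> C) :
  finitely_supported u -> exists N, forall n, (N < n)%nat -> u n = RtoC 0.
Proof.
  intros [l hl]. exists (list_max l). intros n hn.
  destruct (Ceq_dec (u n) (RtoC 0)) as [h | h]; [exact h |].
  assert (hle := proj1 (list_max_le l (list_max l)) (le_n _)).
  rewrite Forall_forall in hle. specialize (hle n (hl n h)). lia.
Qed.

Lemma Cmod_sub_sq_ge (z w : C) : (Cmod z - Cmod w) ^ 2 <= Cmod (Cminus z w) ^ 2.
Proof.
  assert (h1 := Cmod_triangle (Cminus z w) w).
  assert (h2 := Cmod_triangle (Cminus w z) z).
  replace (Cplus (Cminus z w) w) with z in h1 by ring.
  replace (Cplus (Cminus w z) z) with w in h2 by ring.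
  replace (Cminus w z) with (Copp (Cminus z w)) in h2 by ring.
  rewrite Cmod_opp in h2.
  apply pow_maj_Rabs. apply Rabs_le. lra.
Qed.

Theorem theorem5p1 (alpha : R) (u : nat -> C)
    (halpha : 1 < alpha <= 2)
    (hsupp : finitely_supported u)
    (hmax : forall n : nat, Cmod (u n) <= Cmod (u 0%nat)) :
  Series_from_1 (fun n : nat =>
      Cmod (Cminus (u n) (u (n - 1)%nat)) ^ 2 * Rpower (INR n) alpha)
  >= (alpha - 1) ^ 2 / 4 *
     Series_from_1 (fun n : nat => Cmod (u n) ^ 2 * Rpower (INR n) (alpha - 2)).
Proof.
  destruct (finitely_supported_bound u hsupp) as [N hN].
  set (s := (alpha - 1) / 2).
  assert (hs : 0 < s <= 1 / 2) by (unfold s; lra).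
  replace ((alpha - 1) ^ 2 / 4) with (s ^ 2) by (unfold s; field).
  replace (alpha - 2) with (2 * s - 1) by (unfold s; field).
  replace alpha with (1 + 2 * s) by (unfold s; field).
  clearbody s. unfold Series_from_1.
  rewrite (Series_eventually_zero _ N), (Series_eventually_zero _ N).
  2: { intros n hn. rewrite hN, Cmod_0 by lia. ring. }
  2: { intros n hn. rewrite !hN by lia. unfold Cminus.
       rewrite Cplus_opp_r, Cmod_0. ring. }
  apply Rle_ge.
  assert (hsum := hardy_partial_sum s (fun n => Cmod (u n)) N hs).
  cbv beta in hsum.
  rewrite (hN (S N)), Cmod_0 in hsum by lia.
  assert (h0 : 0 <= flux_density s 1 * Cmod (u 0%nat) ^ 2).
  { apply Rmult_le_pos; [left; apply flux_density_pos; lra | apply pow2_ge_0]. }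
  apply Rle_trans with
    (sum_n (fun k => (Cmod (u (S k)) - Cmod (u k)) ^ 2
                     * Rpower (INR (S k)) (1 + 2 * s)) N); [lra |].
  apply sum_n_m_le. intros k.
  replace (S k - 1)%nat with k by lia.
  apply Rmult_le_compat_r; [left; apply exp_pos | apply Cmod_sub_sq_ge].
Qed.
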